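(* Let $q$ be a prime power and let $k\ge 0$ be an integer. Let $W$ be a $\mathrm{GL}_2(\mathbb F_q)$-invariant subspace of $\mathbb F_q[X,Y]_k$, with associated code $C_W$ and dual code $C_W^\perp$. Assume that $k\le q$. Then the following hold: (i) $d(C_W^\perp)\le k+2$. (ii) For every integer $w$ with $3\le w\le q+1$, if $C_W^\perp$ contains codewords of weight $w$, then the supports of all codewords of weight $w$ in $C_W^\perp$ form a $3$-$(q+1,w,\lambda_w)$ design for some $\lambda_w$. In particular, if $d(C_W^\perp)\ge 3$, then the supports of the minimum-weight codewords in $C_W^\perp$ form a $3$-$(q+1,d(C_W^\perp),\lambda)$ design for some $\lambda$.
   Context: $\mathbb F_q[X,Y]_k$ is the $\mathbb F_q$-space of homogeneous polynomials of degree $k$ in $X,Y$ over $\mathbb F_q$ (including $0$). The group $\mathrm{GL}_2(\mathbb F_q)$ acts on it by $(g\cdot f)(X,Y)=f(dX-bY,-cX+aY)$ for $g=\begin{pmatrix}a&b\\c&d\end{pmatrix}$; an $\mathbb F_q$-subspace $W$ is $\mathrm{GL}_2(\mathbb F_q)$-invariant if $g\cdot f\in W$ for all $g\in\mathrm{GL}_2(\mathbb F_q)$ and $f\in W$. $\mathbb P^1(\mathbb F_q)=\mathbb F_q\cup\{\infty\}$. The evaluation map is $\mathrm{Ev}:\mathbb F_q[X,Y]_k\to\mathbb F_q^{q+1}$, $f\mapsto((f(a,1))_{a\in\mathbb F_q},f(1,0))$, with coordinates indexed by $\mathbb P^1(\mathbb F_q)$ (the last one by $\infty$), and $C_W=\mathrm{Ev}(W)$.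 The dual of a code $C\subseteq\mathbb F_q^{q+1}$ is $C^\perp=\{x\in\mathbb F_q^{q+1}:x^Tc=0\ \forall c\in C\}$. For a codeword $c=(c_x)_{x\in\mathbb P^1(\mathbb F_q)}$, its support is $\{x\in\mathbb P^1(\mathbb F_q):c_x\neq0\}$ and its weight is the size of its support. $d(C)$ is the minimum Hamming distance of the linear code $C$, i.e. the minimum weight of a nonzero codeword; minimum-weight codewords are the codewords of weight $d(C)$. A $t$-$(v,k,\lambda)$ design is a pair $(P,\mathcal B)$ with $P$ a finite set, $|P|=v$, and $\mathcal B$ a set (without repetitions) of $k$-subsets of $P$ such that every $t$-subset of $P$ is contained in exactly $\lambda$ members of $\mathcal B$. Here the point set is $P=\mathbb P^1(\mathbb F_q)$. *)

(* Defs.v *)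
From HB Require Import structures.
From mathcomp Require Import all_boot all_order all_algebra.
From mathcomp Require Import mpoly.

Set Implicit Arguments.
Unset Strict Implicit.
Unset Printing Implicit Defensive.

Import GRing.Theory.
Local Open Scope ring_scope.

(* Homogeneous polynomials of degree k in X = 'X_0 and Y = 'X_1, with 0. *)
Notation hform F k := (dhomog 2 F k).

(* The images (dX - bY, -cX + aY) of (X, Y) under g = (a, b; c, d). *)
Definition gl2_subst (F : finFieldType) (g : {'GL_2[F]}) :
    2.-tuple {mpoly F[2]} :=
  let a := GLval g 0 0 in let b := GLval g 0 1 in
  let c := GLval g 1 0 in let d := GLval g 1 1 in
  [tuple d *: 'X_0 - b *: 'X_1; - c *: 'X_0 + a *: 'X_1].

Lemma gl2_subst_homog (F : finFieldType) (g : {'GL_2[F]}) (i : 'I_2) :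
  tnth (gl2_subst g) i \is 1.-homog.
Proof.
have XP j : 'X_j \is [in F[2], 1.-homog] by rewrite dhomogX /= mdeg1.
by case: i => [[|[|//]] ?]; rewrite (tnth_nth 0) /= ?rpredB ?rpredD ?rpredZ.
Qed.

Lemma gl2_act_homog (F : finFieldType) (k : nat) (g : {'GL_2[F]})
    (f : hform F k) :
  ((f : {mpoly F[2]}) \mPo gl2_subst g) \is k.-homog.
Proof.
rewrite comp_mpolyE big_seq; apply: rpred_sum => m m_f; apply: rpredZ.
have <- : mdeg m = k by exact: (dhomog_mf (dhomog_is_dhomog f)).
rewrite !big_ord_recl big_ord0 mulr1 mdegE !big_ord_recl big_ord0 addn0.
by apply: dhomogM; rewrite -[X in X.-homog]mul1n;
   apply: dhomogMn; apply: gl2_subst_homog.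
Qed.

Definition gl2_act (F : finFieldType) (k : nat) (g : {'GL_2[F]})
    (f : hform F k) : hform F k :=
  DHomog (gl2_act_homog g f).

Definition gl2_invariant (F : finFieldType) (k : nat) (W : {vspace hform F k}) :
    Prop :=
  forall (g : {'GL_2[F]}) (f : hform F k), f \in W -> gl2_act g f \in W.

(* The projective line F + {oo}, with oo = None. *)
Definition P1 (F : finFieldType) : finType := option F.

(* Words of length #|I| with coordinates indexed by I; the regular module F^o
   gives them the F-vector space structure. *)
Notation word F I := {ffun I -> F^o}.

Definition P1_coords (F : finFieldType) (x : P1 F) : 'I_2 -> F :=
  let: (u, v) := if x is Some a then (a, 1) else (1, 0) in
  fun i => if i == 0 then u else v.

Definition Ev (F : finFieldType) (k : nat) (f : hform F k) : word F (P1 F) :=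
  [ffun x => (f : {mpoly F[2]}).@[P1_coords x]].

Lemma Ev_is_linear (F : finFieldType) (k : nat) : linear (@Ev F k).
Proof.
by move=> c f g; apply/ffunP=> x; rewrite !ffunE /= mevalD mevalZ.
Qed.

HB.instance Definition _ (F : finFieldType) (k : nat) :=
  GRing.isLinear.Build F (hform F k) (word F (P1 F)) _ (@Ev F k)
    (@Ev_is_linear F k).

Definition code_of (F : finFieldType) (k : nat) (W : {vspace hform F k}) :
    {vspace word F (P1 F)} :=
  (linfun (@Ev F k) @: W)%VS.

Definition dual_code (F : finFieldType) (I : finType) (C : {vspace word F I}) :
    {set word F I} :=
  [set x : word F I | [forall (c : word F I | c \in C), \sum_i x i * c i == 0]].

Definition supp (F : finFieldType) (I : finType) (c : word F I) : {set I} :=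
  [set i | c i != 0].

Definition weight (F : finFieldType) (I : finType) (c : word F I) : nat :=
  #|supp c|.

(* Weights are at most #|I|, so the default value #|I| + 1 is only reached by
   the zero code, whose minimum distance is thus fixed to be length + 1. *)
Definition min_dist (F : finFieldType) (I : finType) (C : {set word F I}) :
    nat :=
  \big[minn/#|I|.+1]_(c in C | c != 0) weight c.

Definition supports (F : finFieldType) (I : finType) (C : {set word F I})
    (w : nat) : {set {set I}} :=
  [set supp c | c in C & weight c == w].

Definition is_design (P : finType) (B : {set {set P}}) (t v k lambda : nat) :
    Prop :=
  [/\ #|P| = v,
      forall b : {set P}, b \in B -> #|b| = k
    & forall T : {set P}, #|T| = t -> #|[set b in B | T \subset b]| = lambda].

(* Main.v *)
(** A matrix [M] of [GL_2(F)] sends a point [x] of the projective line to a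
    multiple [s(x) pi(x)] of a representative of another point, so the value of
    [f (M .)] at [x] is [s(x)^k f(pi(x))] for every form [f] of degree [k].
    Hence invariance of [W] makes the dual code invariant under the monomial
    maps [(c_x) |-> (s(x)^k c_x)] transported along [pi], and its supports
    under [pi].  As [GL_2(F)] is 3-transitive on the projective line, all
    3-subsets lie in the same number of supports of a given weight.  The bound
    on the distance holds because the values of the [k + 1] monomials of degree
    [k] at a point form a vector of length [k + 1], so [k + 2] such vectors are
    linearly dependent. *)

Require Import Defs.
From mathcomp Require Import all_boot all_order all_algebra.
From mathcomp Require Import mpoly.
From mathcomp Require Import ring.

Set Implicit Arguments.
Unset Strict Implicit.
Unset Printing Implicit Defensive.

Import GRing.Theory.

(** * Designs from transitive families of block-preserving maps *)

Section Design.

Variables (P : finType) (B : {set {set P}}).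

Lemma cards3P (A : {set P}) :
  #|A| = 3 ->
  exists x y z : P, [/\ x != y, y != z, z != x & A = [set x; y; z]].
Proof.
move=> cA; have /card_gt2P[x [y [z [[xA yA zA] [xy yz zx]]]]] : 2 < #|A|.
  by rewrite cA.
exists x, y, z; split=> //; apply/eqP; rewrite eq_sym eqEcard cA.
rewrite !subUset !sub1set xA yA zA /=.
by rewrite -setUA cardsU1 !inE negb_or xy [x == z]eq_sym zx cards2 yz.
Qed.

(** The map [p] sends the blocks containing [T] injectively to blocks containing [T']. This bounds
    one count by the other, and exchanging [T] and [T'] gives equality. *)
Lemma transitive_design (t k : nat) :
  (forall b, b \in B -> #|b| = k) ->
  (forall T T' : {set P}, #|T| = t -> #|T'| = t ->
     exists2 p : P -> P, injective p &
       p @: T = T' /\ forall b, b \in B -> p @: b \in B) ->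
  exists lambda : nat, is_design B t #|P| k lambda.
Proof.
move=> Bk tr.
have le (T T' : {set P}) : #|T| = t -> #|T'| = t ->
    #|[set b in B | T \subset b]| <= #|[set b in B | T' \subset b]|.
  move=> cT cT'; have [p p_inj [pT pB]] := tr _ _ cT cT'.
  rewrite -(card_imset _ (imset_inj p_inj)); apply/subset_leq_card/subsetP.
  move=> _ /imsetP[b /[!inE] /andP[bB Tb] ->].
  by rewrite pB //= -pT imsetS.
case: (pickP (fun T : {set P} => #|T| == t)) => [T0 /eqP cT0 | no].
  exists #|[set b in B | T0 \subset b]|; split=> // T cT.
  by apply/eqP; rewrite eqn_leq !le.
by exists 0; split=> // T /eqP; rewrite no.
Qed.

End Design.

Lemma ord2P (i : 'I_2) : i = 0%R \/ i = 1%R.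
Proof. by case: i => [[|[|//]] ?]; [left|right]; apply: val_inj. Qed.

Lemma big_ord2 (R : Type) (idx : R) (op : Monoid.law idx) (E : 'I_2 -> R) :
  \big[op/idx]_i E i = op (E 0%R) (E 1%R).
Proof.
rewrite !big_ord_recl big_ord0 Monoid.mulm1.
by congr (op _ (E _)); apply: val_inj.
Qed.

(** * The action of invertible matrices on the projective line *)

Section ProjectiveLine.

Variable F : finFieldType.
Implicit Types (x y z : P1 F) (v : 'cV[F]_2) (M N : 'M[F]_2).

Local Open Scope ring_scope.

Lemma P1_coordsE :
  ((P1_coords (None : P1 F) 0 = 1) * (P1_coords (None : P1 F) 1 = 0))
  * ((forall a : F, P1_coords (Some a : P1 F) 0 = a)
     * (forall a : F, P1_coords (Some a : P1 F) 1 = 1)).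
Proof. by []. Qed.

Definition rep x : 'cV[F]_2 := \col_i P1_coords x i.

(* Junk value: [proj 0 = None]; as [scale 0 = 0], [scale_proj] still holds. *)
Definition proj v : P1 F := if v 1 0 == 0 then None else Some (v 0 0 / v 1 0).

Definition scale v : F := if v 1 0 == 0 then v 0 0 else v 1 0.

Lemma cV2P (v w : 'cV[F]_2) : v 0 0 = w 0 0 -> v 1 0 = w 1 0 -> v = w.
Proof.
by move=> e0 e1; apply/colP=> i; case: (ord2P i) => ->.
Qed.

Lemma scale_proj v : v = scale v *: rep (proj v).
Proof.
rewrite /scale /proj; apply: cV2P; case: eqP => [v1|/eqP v1];
  by rewrite !mxE /= ?mulr1 ?mulr0 // mulrC divfK.
Qed.

Lemma projZ (a : F) v : a != 0 -> proj (a *: v) = proj v.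
Proof.
move=> a0; rewrite /proj !mxE mulf_eq0 (negPf a0) /=.
by case: eqP => // /eqP v1; rewrite -mulf_div divff // mul1r.
Qed.

Lemma rep_projK x : proj (rep x) = x.
Proof. by case: x => [a|]; rewrite /proj !mxE /= ?oner_eq0 ?divr1 ?eqxx. Qed.

Lemma rep_neq0 x : rep x != 0.
Proof.
apply/eqP=> /colP x0; case: x x0 => [a|] x0.
  by have /eqP := x0 1; rewrite !mxE /= oner_eq0.
by have /eqP := x0 0; rewrite !mxE /= oner_eq0.
Qed.

Lemma scale_neq0 v : v != 0 -> scale v != 0.
Proof. by apply: contraNneq => s0; rewrite (scale_proj v) s0 scale0r. Qed.

Definition mobius M x : P1 F := proj (M *m rep x).

Definition mobius_scale M x : F := scale (M *m rep x).

Lemma mobius_rep M x : M *m rep x = mobius_scale M x *: rep (mobius M x).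
Proof. exact: scale_proj. Qed.

Lemma mobius_scale_neq0 M x : M \in unitmx -> mobius_scale M x != 0.
Proof.
move=> uM; apply: scale_neq0; apply: contra_neq (rep_neq0 x) => Mx0.
by rewrite -(mulKmx uM (rep x)) Mx0 mulmx0.
Qed.

Lemma mobiusM M N x :
  N \in unitmx -> mobius (M *m N) x = mobius M (mobius N x).
Proof.
move=> uN; rewrite [LHS]/mobius -mulmxA mobius_rep -scalemxAr.
by rewrite projZ ?mobius_scale_neq0.
Qed.

Lemma mobiusK M : M \in unitmx -> cancel (mobius M) (mobius (invmx M)).
Proof.
by move=> uM x; rewrite -mobiusM // mulVmx // /mobius mul1mx rep_projK.
Qed.

Lemma mobiusVK M : M \in unitmx -> cancel (mobius (invmx M)) (mobius M).
Proof.
by move=> uM; rewrite -{2}(invmxK M); apply: mobiusK; rewrite unitmx_inv.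
Qed.

Lemma det_mx22 (R : comNzRingType) (A : 'M[R]_2) :
  \det A = A 0 0 * A 1 1 - A 0 1 * A 1 0.
Proof.
rewrite (expand_det_row _ 0) !big_ord_recl big_ord0 addr0 /cofactor !det_mx11.
rewrite !mxE /= expr0 expr1 mul1r mulN1r mulrN.
have l0 (j : 'I_1) : lift 0 j = 1 by rewrite (ord1 j); apply: val_inj.
have l1 (j : 'I_1) : lift 1 j = 0 :> 'I_2 by rewrite (ord1 j); apply: val_inj.
by rewrite l0 !l1.
Qed.

(** The determinant of the matrix with columns [rep x] and [rep y]. *)
Definition bracket x y : F :=
  P1_coords x 0 * P1_coords y 1 - P1_coords y 0 * P1_coords x 1.

Lemma bracket_neq0 x y : x != y -> bracket x y != 0.
Proof.
rewrite /bracket; case: x y => [a|] [b|] //= xy; rewrite !P1_coordsE.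
- by rewrite !mulr1 subr_eq0; apply: contra_neq xy => ->.
- by rewrite mulr0 mul1r sub0r oppr_eq0 oner_eq0.
- by rewrite mulr0 mul1r subr0 oner_eq0.
Qed.

(* The columns are multiples of [rep x] and [rep y] whose sum is a multiple of
   [rep z] (Cramer's rule). *)
Lemma mobius_std x y z : x != y -> y != z -> z != x ->
  exists2 M, M \in unitmx &
    [/\ mobius M None = x, mobius M (Some 0) = y & mobius M (Some 1) = z].
Proof.
move=> /bracket_neq0 xy /bracket_neq0 yz /bracket_neq0 zx.
pose M : 'M[F]_2 := \matrix_(i, j)
  (if j == 0 then bracket y z * P1_coords x i else bracket z x * P1_coords y i).
have Me1 : M *m rep None = bracket y z *: rep x.
  apply/colP=> i; rewrite !mxE big_ord2 !mxE /= !P1_coordsE; ring.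
have Me2 : M *m rep (Some 0) = bracket z x *: rep y.
  apply/colP=> i; rewrite !mxE big_ord2 !mxE /= !P1_coordsE; ring.
have Me3 : M *m rep (Some 1) = - bracket x y *: rep z.
  by apply: cV2P; rewrite !mxE big_ord2 !mxE /= !P1_coordsE /bracket; ring.
exists M.
  rewrite unitmxE unitfE det_mx22 !mxE /=.
  have -> : bracket y z * P1_coords x 0 * (bracket z x * P1_coords y 1)
    - bracket z x * P1_coords y 0 * (bracket y z * P1_coords x 1)
    = bracket y z * bracket z x * bracket x y.
    by rewrite [bracket x y]/bracket; ring.
  by rewrite !mulf_neq0.
by rewrite /mobius Me1 Me2 Me3 !projZ ?oppr_eq0 // !rep_projK.
Qed.

(** Both triples are images of the standard triple oo, 0, 1, so one matrix is composed with the
    inverse of the other. *)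
Lemma mobius_3transitive (T T' : {set P1 F}) : #|T| = 3 -> #|T'| = 3 ->
  exists2 M, M \in unitmx & mobius M @: T = T'.
Proof.
move=> /cards3P[x [y [z [xy yz zx ->]]]].
move=> /cards3P[x' [y' [z' [xy' yz' zx' ->]]]].
have [A uA [<- <- <-]] := mobius_std xy yz zx.
have [A' uA' [<- <- <-]] := mobius_std xy' yz' zx'.
exists (A' *m invmx A); first by rewrite unitmx_mul uA' unitmx_inv.
by rewrite !imsetU !imset_set1 !mobiusM ?unitmx_inv // !mobiusK.
Qed.

End ProjectiveLine.

(** * Symmetries of the dual code *)

Section DualCode.

Variables (F : finFieldType) (k : nat).
Implicit Types (W : {vspace hform F k}) (f : hform F k) (c : word F (P1 F)).

Local Open Scope ring_scope.

Lemma dual_codeP W c :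
  reflect (forall f, f \in W ->
             \sum_x c x * (f : {mpoly F[2]}).@[P1_coords x] = 0)
          (c \in dual_code (code_of W)).
Proof.
rewrite inE; apply: (iffP forall_inP) => [h f fW | h _ /memv_imgP[f fW ->]].
  rewrite -[RHS](eqP (h _ (memv_img (linfun (@Ev F k)) fW))).
  by apply: eq_bigr => x _; rewrite lfunE ffunE.
by rewrite -[X in _ == X](h f fW); apply/eqP/eq_bigr => x _;
  rewrite lfunE ffunE.
Qed.

Lemma meval_homog f (a : F) (v : 'I_2 -> F) :
  (f : {mpoly F[2]}).@[fun i => a * v i] = a ^+ k * (f : {mpoly F[2]}).@[v].
Proof.
rewrite !mevalE big_distrr /= !big_seq; apply: eq_bigr => m mf.
rewrite mulrCA; congr (_ * _).
under eq_bigr do rewrite exprMn.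
rewrite big_split /= prodrXr; congr (_ ^+ _ * _).
by rewrite -mdegE; apply: (dhomog_mf (dhomog_is_dhomog f)).
Qed.

Lemma gl2_substitution W (M : 'M[F]_2) f :
  gl2_invariant W -> M \in unitmx -> f \in W ->
  exists2 f', f' \in W & forall x, (f' : {mpoly F[2]}).@[P1_coords x] =
    mobius_scale M x ^+ k * (f : {mpoly F[2]}).@[P1_coords (mobius M x)].
Proof.
move=> hW uM fW.
(* [gl2_act] substitutes the adjugate of its matrix, so [G] is the adjugate of
   [M]. *)
pose G : 'M[F]_2 := \matrix_(i, j)
  (if i == j then M (1 - i) (1 - j) else - M i j).
(* A 2 x 2 matrix and its adjugate have the same determinant. *)
have uG : G \is a GRing.unit.
  rewrite -[_ \is a _]/(G \in unitmx) unitmxE det_mx22 !mxE /= subr0 subrr.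
  by move: uM; rewrite unitmxE det_mx22 mulrNN [M 1 1 * _]mulrC.
exists (gl2_act (FinRing.Unit uG) f); first exact: hW.
(* Homogeneity absorbs the scalar into the point: the right-hand side becomes the value of [f] at
   [M *m rep x]. *)
move=> x; rewrite -meval_homog /gl2_act /= comp_mpoly_meval.
apply: meval_eq => i.
have -> : mobius_scale M x * P1_coords (mobius M x) i = (M *m rep x) i 0.
  by rewrite mobius_rep !mxE.
case: (ord2P i) => ->; rewrite (tnth_nth 0) /=;
  rewrite !(mevalB, mevalD, mevalN, mevalZ, mevalXU) !mxE big_ord2 !mxE /=;
  by rewrite ?subr0 ?subrr; ring.
Qed.

Lemma supp_mobius W (M : 'M[F]_2) c :
  gl2_invariant W -> M \in unitmx -> c \in dual_code (code_of W) ->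
  exists2 c', c' \in dual_code (code_of W) & supp c' = mobius M @: supp c.
Proof.
move=> hW uM /dual_codeP cW.
(* The factor is chosen so that pairing [c'] with [f] amounts to pairing [c] with the form [f'] of
   [gl2_substitution]; being nonzero, it does not affect supports. *)
pose c' : word F (P1 F) := [ffun y => let x := mobius (invmx M) y in
  mobius_scale M x ^+ k * c x].
have M_inj := can_inj (mobiusK uM).
exists c'.
  apply/dual_codeP=> f fW; have [f' f'W f'E] := gl2_substitution hW uM fW.
  rewrite -[RHS](cW f' f'W) (reindex_inj M_inj).
  by apply: eq_bigr => x _; rewrite ffunE /= mobiusK // f'E mulrCA mulrA.
apply/setP=> y; rewrite -[y](mobiusVK uM) mem_imset //.
rewrite !inE ffunE /= mobiusK // mulf_eq0 negb_or expf_neq0 //.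
exact: mobius_scale_neq0.
Qed.

Lemma supports_design W (w : nat) : gl2_invariant W ->
  exists lambda : nat,
    is_design (supports (dual_code (code_of W)) w) 3 #|P1 F| w lambda.
Proof.
move=> hW; apply: transitive_design => [_ /imsetP[c /setIdP[_ /eqP <-] ->] //|].
move=> T T' cT cT'; have [M uM MT] := mobius_3transitive cT cT'.
have M_inj := can_inj (mobiusK uM).
exists (mobius M) => //; split=> // _ /imsetP[c /setIdP[cW /eqP cw] ->].
have [c' c'W sc'] := supp_mobius hW uM cW; rewrite -sc'; apply: imset_f.
by rewrite inE c'W /= /weight sc' card_imset // -cw.
Qed.

(** * The bound on the minimum distance *)

Lemma min_dist_le_weight (I : finType) (C : {set word F I}) (c : word F I) :
  c \in C -> c != 0 -> (min_dist C <= weight c)%N.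
Proof.
move=> cC c0.
apply: (@Order.TotalTheory.bigmin_le_cond _ nat); exact/andP.
Qed.

Lemma min_dist_le_length (I : finType) (C : {set word F I}) :
  (min_dist C <= #|I|.+1)%N.
Proof. exact: (@Order.TotalTheory.bigmin_le_id _ nat). Qed.

Lemma dual_word_of_low_weight W : (k.+2 <= #|P1 F|)%N ->
  exists c, [/\ c \in dual_code (code_of W), c != 0 & (weight c <= k.+2)%N].
Proof.
move=> hk; pose h (i : 'I_k.+2) : P1 F := enum_val (widen_ord hk i).
have h_inj : injective h.
  by move=> i j /enum_val_inj /(congr1 val) /= ij; apply: val_inj.
(* Row [i] lists the values at [h i] of the monomials of degree [k]; a nonzero [v] with [v *m A = 0]
   exists as there are more rows than columns. *)
pose A : 'M[F]_(k.+2, k.+1) :=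
  \matrix_(i, j) (P1_coords (h i) 0 ^+ j * P1_coords (h i) 1 ^+ (k - j)).
have [v /sub_kermxP vA v0] : exists2 v : 'rV_k.+2, (v <= kermx A)%MS & v != 0.
  apply/rowV0Pn; rewrite kermx_eq0 /row_free neq_ltn.
  by rewrite (leq_ltn_trans (rank_leq_col A)).
(* This extends [v] by zero outside the chosen points: the sum has at most one term, as [h] is
   injective. *)
pose c : word F (P1 F) := [ffun x => \sum_(i | h i == x) v 0 i].
have chE i : c (h i) = v 0 i.
  by rewrite ffunE (eq_bigl (pred1 i)) ?big_pred1_eq // => j; exact: inj_eq.
exists c; split.
- apply/dual_codeP=> f _.
  transitivity (\sum_i v 0 i * (f : {mpoly F[2]}).@[P1_coords (h i)]).
    rewrite [RHS](partition_big h xpredT) //=; apply: eq_bigr => x _.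
    by rewrite ffunE big_distrl; apply: eq_bigr => i /eqP <-.
  under eq_bigr do rewrite mevalE big_distrr /=.
  rewrite exchange_big big_seq big1 //= => m mf.
  have mk : (m 0%R + m 1%R)%N = k.
    transitivity (mdeg m); last exact: (dhomog_mf (dhomog_is_dhomog f)).
    by rewrite mdegE big_ord2.
  have m0k : (m 0%R < k.+1)%N by rewrite ltnS -mk leq_addr.
  have km0 : (k - m 0%R)%N = m 1%R by rewrite -mk addKn.
  (* The monomial [m] corresponds to the column indexed by its exponent in X. *)
  have /rowP/(_ (Ordinal m0k)) := vA; rewrite !mxE => vA0.
  rewrite -[RHS](mulr0 f@_m) -[in RHS]vA0 big_distrr /=; apply: eq_bigr => i _.
  by rewrite mulrCA big_ord2 mxE /= km0.
- apply/eqP=> c0; case/eqP: v0; apply/rowP=> i.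
  by rewrite -chE c0 ffunE mxE.
rewrite /weight -[leqRHS]card_ord -cardsT -(card_imset _ h_inj).
apply/subset_leq_card/subsetP => x; rewrite inE ffunE.
apply: contraNT => /imsetP xh; rewrite big1 // => i /eqP hi.
by case: xh; exists i.
Qed.

End DualCode.

Theorem proposition4 (q k : nat) (F : finFieldType) (hq : #|F| = q)
    (W : {vspace hform F k}) (hW : gl2_invariant W) (hkq : (k <= q)%N) :
  [/\ (min_dist (dual_code (code_of W)) <= k + 2)%N,
      forall w : nat, (3 <= w <= q + 1)%N ->
        (exists c : word F (P1 F),
           c \in dual_code (code_of W) /\ weight c = w) ->
        exists lambda : nat,
          is_design (supports (dual_code (code_of W)) w) 3 (q + 1) w lambda
    & (3 <= min_dist (dual_code (code_of W)))%N ->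
      exists lambda : nat,
        is_design
          (supports (dual_code (code_of W)) (min_dist (dual_code (code_of W))))
          3 (q + 1) (min_dist (dual_code (code_of W))) lambda].
Proof.
have P1q : #|P1 F| = q + 1 by rewrite card_option hq addn1.
split=> [|w _ _|_]; rewrite -?P1q; [|exact: supports_design..].
have [hk|hk] := leqP k.+2 #|P1 F|.
  have [c [cW c0 cw]] := dual_word_of_low_weight W hk.
  by rewrite addn2 (leq_trans (min_dist_le_weight cW c0)).
(* Here q + 1 < k + 2, so the default value q + 2 of [min_dist] is already at most k + 2. *)
by rewrite addn2 (leq_trans (min_dist_le_length _)).
Qed.
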